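(* Let $\Phi:\mathcal{S}(\mathbb{C}^2)\to\mathcal{S}(\mathbb{C}^2)$ be a map such that $$d_{\mathrm{sym}}(\Phi(\rho),\Phi(\omega))=d_{\mathrm{sym}}(\rho,\omega)\qquad\text{for all }\rho,\omega\in\mathcal{S}(\mathbb{C}^2),$$ and such that $\Phi$ maps pure states to pure states, i.e. $\Phi(\mathcal{P}_1(\mathbb{C}^2))\subseteq\mathcal{P}_1(\mathbb{C}^2)$. Then there is an operator $U$ on $\mathbb{C}^2$ which is either unitary or anti-unitary such that $\Phi(\rho)=U\rho U^*$ for all $\rho\in\mathcal{S}(\mathbb{C}^2)$. Conversely, for every unitary or anti-unitary $U$ on $\mathbb{C}^2$, the map $\rho\mapsto U\rho U^*$ is a $d_{\mathrm{sym}}$-isometry of $\mathcal{S}(\mathbb{C}^2)$.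
   Context: Let $\mathcal{H}=\mathbb{C}^2$, $\mathcal{H}^*$ its dual space. $\mathcal{S}(\mathcal{H})$ is the set of density operators (positive semidefinite, trace one) on $\mathcal{H}$; $\mathcal{P}_1(\mathcal{H})$ is the set of pure states (rank-one orthogonal projections). For a linear operator $A$ on $\mathcal{H}$, its transpose $A^T$ is the operator on $\mathcal{H}^*$ defined by $(A^T\varphi)(x)=\varphi(Ax)$. For $\rho,\omega\in\mathcal{S}(\mathcal{H})$, the set of quantum couplings is $\mathcal{C}(\rho,\omega)=\{\Pi\in\mathcal{S}(\mathcal{H}\otimes\mathcal{H}^* ):\ \mathrm{tr}_{\mathcal{H}^*}[\Pi]=\omega,\ \mathrm{tr}_{\mathcal{H}}[\Pi]=\rho^T\}$. For a finite set $\mathcal{A}=\{A_1,\dots,A_N\}$ of self-adjoint operators, the cost operator is $C_{\mathcal{A}}=\sum_{j=1}^N(A_j\otimes I^T-I\otimes A_j^T)^2$, the quantum Wasserstein distance is given by $D_{\mathcal{A}}^2(\rho,\omega)=\inf\{\mathrm{tr}[\Pi C_{\mathcal{A}}]:\Pi\in\mathcal{C}(\rho,\omega)\}$, and the quantum Wasserstein divergence is $d_{\mathcal{A}}(\rho,\omega)=\big(D_{\mathcal{A}}^2(\rho,\omega)-\tfrac12(D_{\mathcal{A}}^2(\rho,\rho)+D_{\mathcal{A}}^2(\omega,\omega))\big)^{1/2}$. The Pauli matrices are $\sigma_1=\begin{bmatrix}0&1\\1&0\end{bmatrix}$, $\sigma_2=\begin{bmatrix}0&-i\\i&0\end{bmatrix}$,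 $\sigma_3=\begin{bmatrix}1&0\\0&-1\end{bmatrix}$. $D_{\mathrm{sym}}$ and $d_{\mathrm{sym}}$ denote $D_{\mathcal{A}}$ and $d_{\mathcal{A}}$ for $\mathcal{A}=\{\sigma_1,\sigma_2,\sigma_3\}$. *)

(* Defs.v *)
From HB Require Import structures.
From mathcomp Require Import all_boot all_order all_algebra.
From mathcomp Require Import classical_sets reals.
From mathcomp.real_closed Require Import complex mxtens.
Set Implicit Arguments.
Unset Strict Implicit.
Unset Printing Implicit Defensive.
Import Order.TTheory GRing.Theory Num.Theory Num.Syntax.
Local Open Scope ring_scope.

Section QW.
Variable R : realType.
Local Notation C := R[i].

Definition conj_mx m n (A : 'M[C]_(m, n)) : 'M[C]_(m, n) := map_mx Num.conj A.
Definition adj m n (A : 'M[C]_(m, n)) : 'M[C]_(n, m) := (conj_mx A)^T.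

Definition psd n (A : 'M[C]_n) : Prop :=
  A = adj A /\ forall v : 'cV[C]_n, 0 <= (adj v *m A *m v) 0 0.

Definition density n (A : 'M[C]_n) : Prop := psd A /\ \tr A = 1.

Definition pure (A : 'M[C]_2) : Prop :=
  A = adj A /\ A *m A = A /\ \rank A = 1%N.

Definition unitary (V : 'M[C]_2) : Prop := V *m adj V = 1%:M.

(* Partial traces on H (x) H^*, with H^* identified with C^2 via the dual basis
   (so that A^T is the matrix transpose) and the index (i, j) of H (x) H^*
   encoded by mxtens_index. *)
Definition ptr_Hstar (P : 'M[C]_(2 * 2)) : 'M[C]_2 :=
  \matrix_(i, k) \sum_(j < 2) P (mxtens_index (i, j)) (mxtens_index (k, j)).
Definition ptr_H (P : 'M[C]_(2 * 2)) : 'M[C]_2 :=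
  \matrix_(j, l) \sum_(i < 2) P (mxtens_index (i, j)) (mxtens_index (i, l)).

Definition coupling (rho omega : 'M[C]_2) (P : 'M[C]_(2 * 2)) : Prop :=
  density P /\ ptr_Hstar P = omega /\ ptr_H P = rho^T.

Definition cost_op (As : seq 'M[C]_2) : 'M[C]_(2 * 2) :=
  \sum_(A <- As)
    let X := A *t (1%:M : 'M[C]_2)^T - (1%:M : 'M[C]_2) *t A^T in X *m X.

(* squared quantum Wasserstein distance D_A^2 (the trace is real for couplings;
   we take its real part) *)
Definition D2 (As : seq 'M[C]_2) (rho omega : 'M[C]_2) : R :=
  inf [set x : R | exists P, coupling rho omega P /\
                             x = complex.Re (\tr (P *m cost_op As))].

Definition dA (As : seq 'M[C]_2) (rho omega : 'M[C]_2) : R :=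
  Num.sqrt (D2 As rho omega - (D2 As rho rho + D2 As omega omega) / 2).

Definition sigma1 : 'M[C]_2 :=
  \matrix_(i, j) if i == j then 0 else 1.
Definition sigma2 : 'M[C]_2 :=
  \matrix_(i, j) if i == j then 0 else if i == ord0 then - 'i else 'i.
Definition sigma3 : 'M[C]_2 :=
  \matrix_(i, j) if i == j then (if i == ord0 then 1 else -1) else 0.

Definition d_sym (rho omega : 'M[C]_2) : R := dA [:: sigma1; sigma2; sigma3] rho omega.

(* rho |-> U rho U^* for U unitary (U = V) resp. U antiunitary (U = V o K,
   K the complex conjugation in the standard basis, V unitary; every antiunitary
   on C^2 is of this form, and then U rho U^* = V conj(rho) V^* ) *)
Definition unitary_conj (V rho : 'M[C]_2) : 'M[C]_2 := V *m rho *m adj V.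
Definition antiunitary_conj (V rho : 'M[C]_2) : 'M[C]_2 := V *m conj_mx rho *m adj V.

End QW.

(* Main.v *)
(** Write [w = vecc 1] for the unnormalised maximally entangled vector.  The cost
    operator of the three Pauli matrices is [8 - 4 w w^*], so the cost of a coupling
    [P] is [8 - 4 <w, P w>].  This quantity is invariant under conjugation of [P] by
    [V (x) conj V] and under complex conjugation, which gives the converse part.

    If [omega] is pure, the only coupling of [rho] and [omega] is the product, hence
    [D^2(rho, omega) = 8 - 4 tr (rho omega)].  The canonical purification shows
    [D^2(rho, rho) <= 4], so for pure [omega] the square root in [d_sym rho omega]
    has the nonnegative argument [6 - 4 tr (rho omega) - D^2(rho, rho) / 2].  Comparing
    these for the two orthogonal pure states [E0], [E1] and their images, which are
    again orthogonal, eliminates the unknown [D^2(rho, rho)]: the isometry preserves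
    [tr (rho omega)] for every state [rho] and every pure [omega].  After composition
    with a unitary it fixes the eigenprojections [E0], [E1], [Px] of the third and
    first Pauli matrices and sends [Py] to itself or to its conjugate; these four
    states span the 2x2 matrices. *)
Require Import Defs.
From HB Require Import structures.
From mathcomp Require Import all_boot all_order all_algebra.
From mathcomp Require Import classical_sets reals.
From mathcomp.real_closed Require Import complex mxtens.
From mathcomp Require Import ring lra.
Set Implicit Arguments.
Unset Strict Implicit.
Unset Printing Implicit Defensive.
Import Order.TTheory GRing.Theory Num.Theory.
Local Open Scope ring_scope.

(** * Adjoints, positivity and unitary conjugation *)

Section Adjoint.
Variable R : realType.
Local Notation C := R[i].

Lemma adjE m n (A : 'M[C]_(m, n)) i j : adj A i j = (A j i)^*.
Proof. by rewrite !mxE. Qed.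

Lemma conj_mxK m n (A : 'M[C]_(m, n)) : conj_mx (conj_mx A) = A.
Proof. by apply/matrixP => i j; rewrite !mxE conjCK. Qed.

Lemma conj_mxM m n p (A : 'M[C]_(m, n)) (B : 'M_(n, p)) :
  conj_mx (A *m B) = conj_mx A *m conj_mx B.
Proof. exact: map_mxM. Qed.

Lemma adjK m n (A : 'M[C]_(m, n)) : adj (adj A) = A.
Proof. by apply/matrixP => i j; rewrite !adjE conjCK. Qed.

Lemma adjM m n p (A : 'M[C]_(m, n)) (B : 'M_(n, p)) :
  adj (A *m B) = adj B *m adj A.
Proof. by rewrite /adj conj_mxM trmx_mul. Qed.

Lemma adjD m n (A B : 'M[C]_(m, n)) : adj (A + B) = adj A + adj B.
Proof. by apply/matrixP => i j; rewrite !mxE rmorphD. Qed.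

Lemma adj_scale m n (a : C) (A : 'M[C]_(m, n)) : adj (a *: A) = a^* *: adj A.
Proof. by apply/matrixP => i j; rewrite !mxE rmorphM. Qed.

Lemma adj_scalar n (a : C) : adj (a%:M : 'M[C]_n) = (a^*)%:M.
Proof.
by apply/matrixP => i j; rewrite !mxE eq_sym; case: eqP => _; rewrite ?conjC0.
Qed.

Lemma adj_tens m n p q (A : 'M[C]_(m, n)) (B : 'M[C]_(p, q)) :
  adj (A *t B) = adj A *t adj B.
Proof. by rewrite /adj /conj_mx (map_mxT Num.conj) trmx_tens. Qed.

Lemma conj_adj m n (A : 'M[C]_(m, n)) : adj (conj_mx A) = A^T.
Proof. by rewrite /adj conj_mxK. Qed.

Lemma mxtrace_conj n (A : 'M[C]_n) : \tr (conj_mx A) = (\tr A)^*.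
Proof. by rewrite /mxtrace rmorph_sum; apply: eq_bigr => i _; rewrite mxE. Qed.

Lemma mxtrace_adj n (A : 'M[C]_n) : \tr (adj A) = (\tr A)^*.
Proof. by rewrite mxtrace_tr mxtrace_conj. Qed.

Lemma mxtrace_herm_real n (A B : 'M[C]_n) :
  A = adj A -> B = adj B -> (\tr (A *m B))^* = \tr (A *m B).
Proof. by move=> hA hB; rewrite -mxtrace_adj adjM -hA -hB mxtrace_mulC. Qed.

(** Nondegeneracy of the trace form, tested on matrix units. It lets partial traces be computed by
    duality. *)
Lemma mxtrace_mul_inj n (A B : 'M[C]_n) :
  (forall M : 'M[C]_n, \tr (A *m M) = \tr (B *m M)) -> A = B.
Proof.
move=> h; apply/matrixP => i j; have := h (delta_mx j i).
have tr_delta (D : 'M[C]_n) : \tr (D *m delta_mx j i) = D i j.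
  rewrite /mxtrace (bigD1 i) //= big1 ?addr0.
    rewrite mxE (bigD1 j) //= big1 ?addr0; first by rewrite mxE !eqxx mulr1.
    by move=> k kj; rewrite mxE (negPf kj) mulr0.
  move=> k ki; rewrite mxE big1 // => l _.
  by rewrite mxE (negPf ki) andbF mulr0.
by rewrite !tr_delta.
Qed.

Lemma gram_psd m n (K : 'M[C]_(n, m)) : psd (K *m adj K).
Proof.
split=> [|v]; first by rewrite adjM adjK.
rewrite mulmxA -mulmxA -[K in adj v *m K]adjK -adjM mxE.
by apply: sumr_ge0 => i _; rewrite adjE mulrC mul_conjC_ge0.
Qed.

Lemma psd_congr m n (K : 'M[C]_(n, m)) (A : 'M[C]_m) :
  psd A -> psd (K *m A *m adj K).
Proof.
move=> [hA pA]; split=> [|v]; first by rewrite !adjM adjK -hA !mulmxA.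
by have := pA (adj K *m v); rewrite adjM adjK !mulmxA.
Qed.

(** The quadratic form of [conj_mx A] at [v] is the conjugate of the form of [A] at [conj_mx v]. *)
Lemma psd_conj n (A : 'M[C]_n) : psd A -> psd (conj_mx A).
Proof.
move=> [hA pA]; split=> [|v].
  by rewrite conj_adj [in LHS]hA; apply/matrixP => i j; rewrite !mxE conjCK.
have := pA (conj_mx v).
rewrite /adj conj_mxK -conjC_ge0.
have -> : ((v^T *m A *m conj_mx v) 0 0)^* =
  conj_mx (v^T *m A *m conj_mx v) 0 0 by rewrite [RHS]mxE.
by rewrite !conj_mxM conj_mxK /conj_mx map_trmx.
Qed.

Lemma unitaryC (V : 'M[C]_2) : unitary V -> adj V *m V = 1%:M.
Proof. by move/mulmx1C. Qed.

Lemma unitary_adj (V : 'M[C]_2) : unitary V -> unitary (adj V).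
Proof. by move/unitaryC => h; rewrite /unitary adjK. Qed.

Lemma unitary_conjK (V A : 'M[C]_2) :
  unitary V -> unitary_conj V (unitary_conj (adj V) A) = A.
Proof.
move=> hV; rewrite /unitary_conj adjK !mulmxA hV mul1mx.
by rewrite -mulmxA hV mulmx1.
Qed.

Lemma unitary_conjKV (V A : 'M[C]_2) :
  unitary V -> unitary_conj (adj V) (unitary_conj V A) = A.
Proof.
by move=> hV; have := unitary_conjK A (unitary_adj hV); rewrite adjK.
Qed.

Lemma mxtrace_unitary_conj (V A B : 'M[C]_2) : unitary V ->
  \tr (unitary_conj V A *m unitary_conj V B) = \tr (A *m B).
Proof.
move=> hV; rewrite /unitary_conj !mulmxA -[_ *m adj V *m V]mulmxA.
by rewrite (unitaryC hV) mulmx1 mxtrace_mulC !mulmxA (unitaryC hV) mul1mx.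
Qed.

Lemma unitary_mul (V W : 'M[C]_2) : unitary V -> unitary W -> unitary (V *m W).
Proof.
move=> hV hW; rewrite /unitary adjM mulmxA -[V *m W *m _]mulmxA.
by rewrite hW mulmx1.
Qed.

Lemma density_unitary_conj (V A : 'M[C]_2) :
  unitary V -> density A -> density (unitary_conj V A).
Proof.
move=> hV [pA tA]; split; first exact: psd_congr.
by rewrite /unitary_conj mxtrace_mulC mulmxA (unitaryC hV) mul1mx.
Qed.

End Adjoint.

(** * Vectorisation and the Pauli cost operator *)

Section Couplings.
Variable R : realType.
Local Notation C := R[i].
Local Notation paulis := [:: sigma1 R; sigma2 R; sigma3 R].

Lemma sum_mxtens (V : nmodType) m n (F : 'I_(m * n) -> V) :
  \sum_x F x = \sum_i \sum_j F (mxtens_index (i, j)).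
Proof.
rewrite (reindex (@mxtens_index m n)) /=; last first.
  exact/onW_bij/(Bijective (@mxtens_indexK m n) (@mxtens_unindexK m n)).
by rewrite pair_big; apply: eq_bigr => -[i j].
Qed.

Lemma sum_ord2 (V : nmodType) (F : 'I_2 -> V) : \sum_i F i = F 0 + F 1.
Proof.
rewrite !big_ord_recl big_ord0 addr0; congr (_ + F _); exact/val_inj.
Qed.

Variant ord2_spec : 'I_2 -> Prop := Ord2_0 : ord2_spec 0 | Ord2_1 : ord2_spec 1.

Lemma ord2P i : ord2_spec i.
Proof.
case: i => [[|[|//]] p].
  by have -> : Ordinal p = 0; [exact/val_inj | left].
by have -> : Ordinal p = 1; [exact/val_inj | right].
Qed.

Lemma mx2_eq (A B : 'M[C]_2) : A 0 0 = B 0 0 -> A 0 1 = B 0 1 ->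
  A 1 0 = B 1 0 -> A 1 1 = B 1 1 -> A = B.
Proof.
by move=> h00 h01 h10 h11; apply/matrixP => i j; case/ord2P: i; case/ord2P: j.
Qed.

Lemma mxtrace2 (A : 'M[C]_2) : \tr A = A 0 0 + A 1 1.
Proof. exact: sum_ord2. Qed.

Lemma mulmx2E (A B : 'M[C]_2) i j : (A *m B) i j = A i 0 * B 0 j + A i 1 * B 1 j.
Proof. by rewrite mxE sum_ord2. Qed.

(** Row-major vectorisation, the coordinate form of the isomorphism between operators on H and
    vectors of the tensor product of H and its dual. *)
Definition vecc (X : 'M[C]_2) : 'cV[C]_(2 * 2) :=
  \col_x X (mxtens_unindex x).1 (mxtens_unindex x).2.

Lemma veccE X i j k : vecc X (mxtens_index (i, j)) k = X i j.
Proof. by rewrite mxE mxtens_indexK. Qed.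

Lemma tens_vecc (A B X : 'M[C]_2) : (A *t B) *m vecc X = vecc (A *m X *m B^T).
Proof.
apply/matrixP => x y; case: (mxtens_indexP x) => i j.
rewrite veccE mxE sum_mxtens exchange_big !mxE /=; apply: eq_bigr => l _.
rewrite !mxE mulr_suml; apply: eq_bigr => k _.
by rewrite tensmxE veccE; ring.
Qed.

Lemma mxtens_index_eq m n (i k : 'I_m) (j l : 'I_n) :
  (mxtens_index (i, j) == mxtens_index (k, l)) = (i == k) && (j == l).
Proof. by rewrite (can_eq (@mxtens_indexK m n)) xpair_eqE. Qed.

Lemma tens1 : (1%:M *t 1%:M : 'M[C]_(2 * 2)) = 1%:M.
Proof.
apply/matrixP => x y; case: (mxtens_indexP x) => i j.
case: (mxtens_indexP y) => k l; rewrite tensmxE !mxE mxtens_index_eq.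
by rewrite -natrM mulnb.
Qed.

(** The two tensor terms commute and each squares to the identity, so only the cross term
    survives. *)
Lemma pauli_cost (A : 'M[C]_2) : A *m A = 1%:M ->
  let X := A *t (1%:M)^T - (1%:M : 'M[C]_2) *t A^T in
  X *m X = 2%:M - 2 *: (A *t A^T).
Proof.
move=> AA /=; rewrite trmx1 mulmxBl !mulmxBr !tensmx_mul !mulmx1 !mul1mx.
rewrite -trmx_mul AA trmx1 !tens1; move: (A *t A^T) => T.
by apply/matrixP => x y; rewrite !mxE; case: eqP => _; ring.
Qed.

Lemma sigma1_sq : sigma1 R *m sigma1 R = 1%:M.
Proof. by apply: mx2_eq; rewrite mulmx2E !mxE /=; ring. Qed.

Lemma sigma2_sq : sigma2 R *m sigma2 R = 1%:M.
Proof.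
have ii := sqrCi C; rewrite expr2 in ii.
by apply: mx2_eq; rewrite mulmx2E !mxE /= ?mulNr ?mulrN ?ii; ring.
Qed.

Lemma sigma3_sq : sigma3 R *m sigma3 R = 1%:M.
Proof. by apply: mx2_eq; rewrite mulmx2E !mxE /=; ring. Qed.

(** Completeness relation of the Pauli matrices, with the indices of the second factor already
    transposed as the cost operator needs them. *)
Lemma pauli_fierz (i j k l : 'I_2) :
  sigma1 R i k * sigma1 R l j + sigma2 R i k * sigma2 R l j
    + sigma3 R i k * sigma3 R l j
  = 2 * ((i == j)%:R * (k == l)%:R) - (i == k)%:R * (j == l)%:R.
Proof.
have ii := sqrCi C; rewrite expr2 in ii.
case/ord2P: i; case/ord2P: j; case/ord2P: k; case/ord2P: l;
  by rewrite !mxE /= ?mulNr ?mulrN ?ii; ring.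
Qed.

(** Transposing the second factor turns the swap operator of the completeness relation into the
    rank-one operator of the maximally entangled vector. *)
Lemma sum_pauli_tens :
  sigma1 R *t (sigma1 R)^T + sigma2 R *t (sigma2 R)^T + sigma3 R *t (sigma3 R)^T
  = 2 *: (vecc 1%:M *m adj (vecc 1%:M)) - 1%:M.
Proof.
(* These separate entry rules avoid [mxE], which would unfold the Pauli matrices before
   [pauli_fierz] can apply. *)
have trE (A : 'M[C]_2) i j : A^T i j = A j i by rewrite mxE.
have addE (A B : 'M[C]_(2 * 2)) x y : (A + B) x y = A x y + B x y by rewrite mxE.
have oppE (A : 'M[C]_(2 * 2)) x y : (- A) x y = - A x y by rewrite mxE.
have sclE (A : 'M[C]_(2 * 2)) a x y : (a *: A) x y = a * A x y by rewrite mxE.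
have oneE n (x y : 'I_n) : (1%:M : 'M[C]_n) x y = (x == y)%:R by rewrite mxE.
apply/matrixP => x y; case: (mxtens_indexP x) => i j.
case: (mxtens_indexP y) => k l.
rewrite !addE oppE sclE !tensmxE !trE pauli_fierz oneE mxtens_index_eq.
rewrite -mulnb natrM; congr (_ * _ - _).
by rewrite mxE big_ord_recl big_ord0 addr0 adjE !veccE !oneE conjC_nat.
Qed.

Lemma cost_op3 (A B D : 'M[C]_2) :
  A *m A = 1%:M -> B *m B = 1%:M -> D *m D = 1%:M ->
  cost_op [:: A; B; D] = 6%:M - 2 *: (A *t A^T + B *t B^T + D *t D^T).
Proof.
move=> AA BB DD; have sum3 (F : 'M[C]_2 -> 'M[C]_(2 * 2)) :
    \sum_(M <- [:: A; B; D]) F M = F A + F B + F D.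
  by rewrite !big_cons big_nil addr0 addrA.
rewrite /cost_op sum3; apply: etrans (congr2 +%R (congr2 +%R
  (pauli_cost AA) (pauli_cost BB)) (pauli_cost DD)) _.
move: (A *t _) (B *t _) (D *t _) => T1 T2 T3.
by apply/matrixP => x y; rewrite !mxE; case: eqP => _; ring.
Qed.

Lemma cost_paulis :
  cost_op paulis = 8%:M - 4 *: (vecc 1%:M *m adj (vecc 1%:M)).
Proof.
rewrite (cost_op3 sigma1_sq sigma2_sq sigma3_sq) sum_pauli_tens.
move: (vecc _ *m _) => W.
by apply/matrixP => x y; rewrite !mxE; case: eqP => _; ring.
Qed.

End Couplings.

(** * Partial traces and the invariance of the distance under unitaries and conjugation *)

Section Invariance.
Variable R : realType.
Local Notation C := R[i].
Local Notation paulis := [:: sigma1 R; sigma2 R; sigma3 R].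

Lemma mxtrace_mulE n (A B : 'M[C]_n) : \tr (A *m B) = \sum_i \sum_j A i j * B j i.
Proof. by apply: eq_bigr => i _; rewrite mxE. Qed.

(** The partial trace is dual to tensoring with the identity; this reduces its behaviour under
    congruence to cyclicity of the trace. *)
Lemma mxtrace_ptr_Hstar (P : 'M[C]_(2 * 2)) (M : 'M[C]_2) :
  \tr (ptr_Hstar P *m M) = \tr (P *m (M *t 1%:M)).
Proof.
have oneE (x y : 'I_2) : (1%:M : 'M[C]_2) x y = (x == y)%:R by rewrite mxE.
rewrite !mxtrace_mulE sum_mxtens; apply: eq_bigr => i _.
under [RHS]eq_bigr => j _ do rewrite sum_mxtens.
rewrite [RHS]exchange_big /=; apply: eq_bigr => k _.
rewrite mxE mulr_suml; apply: eq_bigr => j _.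
rewrite (bigD1 j) //= big1 ?addr0; last first.
  by move=> l /negPf lj; rewrite tensmxE oneE lj !mulr0.
by rewrite tensmxE oneE eqxx mulr1.
Qed.

Lemma mxtrace_ptr_H (P : 'M[C]_(2 * 2)) (M : 'M[C]_2) :
  \tr (ptr_H P *m M) = \tr (P *m (1%:M *t M)).
Proof.
have oneE (x y : 'I_2) : (1%:M : 'M[C]_2) x y = (x == y)%:R by rewrite mxE.
rewrite !mxtrace_mulE sum_mxtens [RHS]exchange_big; apply: eq_bigr => j _ /=.
under [RHS]eq_bigr => i _ do rewrite sum_mxtens exchange_big.
rewrite [RHS]exchange_big /=; apply: eq_bigr => l _.
rewrite mxE mulr_suml; apply: eq_bigr => i _.
rewrite (bigD1 i) //= big1 ?addr0; last first.
  by move=> k /negPf ki; rewrite tensmxE oneE ki mul0r mulr0.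
by rewrite tensmxE oneE eqxx mul1r.
Qed.

Lemma mxtrace_congr m n (K : 'M[C]_(m, n)) (A : 'M_n) (N : 'M_m) :
  \tr (K *m A *m adj K *m N) = \tr (A *m (adj K *m N *m K)).
Proof. by rewrite -!mulmxA mxtrace_mulC !mulmxA. Qed.

Lemma ptr_Hstar_congr (A B : 'M[C]_2) (P : 'M[C]_(2 * 2)) : unitary B ->
  ptr_Hstar ((A *t B) *m P *m adj (A *t B)) = unitary_conj A (ptr_Hstar P).
Proof.
move=> hB; apply: mxtrace_mul_inj => M.
rewrite mxtrace_ptr_Hstar /unitary_conj !mxtrace_congr mxtrace_ptr_Hstar adj_tens.
by rewrite !tensmx_mul mulmx1 (unitaryC hB).
Qed.

Lemma ptr_H_congr (A B : 'M[C]_2) (P : 'M[C]_(2 * 2)) : unitary A ->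
  ptr_H ((A *t B) *m P *m adj (A *t B)) = unitary_conj B (ptr_H P).
Proof.
move=> hA; apply: mxtrace_mul_inj => M.
rewrite mxtrace_ptr_H /unitary_conj !mxtrace_congr mxtrace_ptr_H adj_tens.
by rewrite !tensmx_mul mulmx1 (unitaryC hA).
Qed.

Lemma ptr_Hstar_tens (A B : 'M[C]_2) : ptr_Hstar (A *t B) = \tr B *: A.
Proof.
apply/matrixP => i k; rewrite !mxE mulr_suml; apply: eq_bigr => j _.
by rewrite tensmxE mulrC.
Qed.

Lemma ptr_H_tens (A B : 'M[C]_2) : ptr_H (A *t B) = \tr A *: B.
Proof.
apply/matrixP => j l; rewrite !mxE mulr_suml; apply: eq_bigr => i _.
by rewrite tensmxE.
Qed.

Lemma mxtrace_tens (A B : 'M[C]_2) : \tr (A *t B) = \tr A * \tr B.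
Proof.
rewrite [LHS]sum_mxtens mulr_suml; apply: eq_bigr => i _.
by rewrite mulr_sumr; apply: eq_bigr => j _; rewrite tensmxE.
Qed.

(** The only feature of a coupling that enters its Pauli cost. *)
Definition overlap (P : 'M[C]_(2 * 2)) : C := (adj (vecc 1%:M) *m P *m vecc 1%:M) 0 0.

Lemma overlapE P : overlap P =
  \sum_i \sum_k P (mxtens_index (i, i)) (mxtens_index (k, k)).
Proof.
have oneE (x y : 'I_2) : (1%:M : 'M[C]_2) x y = (x == y)%:R by rewrite mxE.
rewrite /overlap -mulmxA mxE sum_mxtens; apply: eq_bigr => i _.
rewrite (bigD1 i) //= big1 ?addr0; last first.
  by move=> j /negPf ji; rewrite adjE veccE oneE eq_sym ji conjC0 mul0r.
rewrite adjE veccE oneE eqxx conjC1 mul1r mxE sum_mxtens; apply: eq_bigr => k _.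
rewrite (bigD1 k) //= big1 ?addr0; last first.
  by move=> j /negPf ji; rewrite veccE oneE eq_sym ji mulr0.
by rewrite veccE oneE eqxx mulr1.
Qed.

Lemma mxtrace_cost P :
  \tr (P *m cost_op paulis) = 8 * \tr P - 4 * overlap P.
Proof.
rewrite cost_paulis mulmxBr mul_mx_scalar linearB /= linearZ /=.
by rewrite -scalemxAr linearZ /= mulmxA mxtrace_mulC mulmxA /mxtrace big_ord1.
Qed.

Lemma Re_cost P : \tr P = 1 ->
  complex.Re (\tr (P *m cost_op paulis)) = 8 - 4 * complex.Re (overlap P).
Proof.
move=> tP; rewrite mxtrace_cost tP mulr1.
(* Numerals are rewritten as embedded reals so that the real part computes. *)
have natE n : n%:R = (n%:R : R)%:C%C :> C by rewrite rmorph_nat.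
by rewrite !natE; case: (overlap P) => a b /=; ring.
Qed.

(** By [tens_vecc], the operator [V *t conj_mx V] and its adjoint fix the vectorised identity when
    [V] is unitary. *)
Lemma overlap_unitary (V : 'M[C]_2) P : unitary V ->
  overlap ((V *t conj_mx V) *m P *m adj (V *t conj_mx V)) = overlap P.
Proof.
move=> hV; rewrite /overlap.
have hw : adj (V *t conj_mx V) *m vecc 1%:M = vecc 1%:M.
  by rewrite adj_tens tens_vecc mulmx1 conj_adj trmxK (unitaryC hV).
have hw' : adj (vecc 1%:M) *m (V *t conj_mx V) = adj (vecc 1%:M : 'cV[C]_(2 * 2)).
  by rewrite -[in RHS]hw adjM adjK.
by rewrite -!mulmxA hw !mulmxA hw'.
Qed.

Lemma unitary_conj_mx (V : 'M[C]_2) : unitary V -> unitary (conj_mx V).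
Proof.
move=> hV; rewrite /unitary.
have <- : conj_mx (1%:M : 'M[C]_2) = 1%:M by exact: map_mx1.
rewrite -hV conj_mxM; congr (_ *m _).
by rewrite conj_adj; apply/matrixP => i j; rewrite !mxE conjCK.
Qed.

(** The second factor carries [conj_mx V] because conjugating [rho^T] by it gives the transpose of
    [unitary_conj V rho]. *)
Lemma coupling_unitary (V rho omega : 'M[C]_2) P : unitary V ->
  coupling rho omega P ->
  coupling (unitary_conj V rho) (unitary_conj V omega)
    ((V *t conj_mx V) *m P *m adj (V *t conj_mx V)).
Proof.
move=> hV [[pP tP] [h1 h2]]; split; [split|split].
- exact: psd_congr.
- rewrite mxtrace_mulC mulmxA adj_tens tensmx_mul.
  by rewrite (unitaryC hV) (unitaryC (unitary_conj_mx hV)) tens1 mul1mx.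
- by rewrite ptr_Hstar_congr ?h1 //; apply: unitary_conj_mx.
- rewrite ptr_H_congr // h2 /unitary_conj !trmx_mul conj_adj mulmxA.
  by congr (_ *m _ *m _); rewrite /adj trmxK.
Qed.

Lemma coupling_cost_unitary (V rho omega : 'M[C]_2) x : unitary V ->
  (exists P, coupling rho omega P /\ x = complex.Re (\tr (P *m cost_op paulis))) ->
  exists P, coupling (unitary_conj V rho) (unitary_conj V omega) P /\
    x = complex.Re (\tr (P *m cost_op paulis)).
Proof.
move=> hV [P [cP ->]]; have cP' := coupling_unitary hV cP.
exists ((V *t conj_mx V) *m P *m adj (V *t conj_mx V)); split => //.
case: cP cP' => [[_ tP] _] [[_ tP'] _].
by rewrite !Re_cost // overlap_unitary.
Qed.

(** Couplings are carried over at equal cost, and [adj V] carries them back, so both infima run over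
    the same set of costs. *)
Lemma D2_unitary (V rho omega : 'M[C]_2) : unitary V ->
  D2 paulis (unitary_conj V rho) (unitary_conj V omega) = D2 paulis rho omega.
Proof.
move=> hV; congr inf; apply/seteqP; split => x /=; last exact: coupling_cost_unitary.
by move/(coupling_cost_unitary (unitary_adj hV)); rewrite !unitary_conjKV.
Qed.

Lemma coupling_conj (rho omega : 'M[C]_2) P :
  coupling rho omega P -> coupling (conj_mx rho) (conj_mx omega) (conj_mx P).
Proof.
move=> [[pP tP] [h1 h2]]; split; [split|split].
- exact: psd_conj.
- by rewrite mxtrace_conj tP conjC1.
- rewrite -h1; apply/matrixP => i k; rewrite !mxE rmorph_sum.
  by apply: eq_bigr => j _; rewrite mxE.
- have <- : conj_mx rho^T = (conj_mx rho)^T by rewrite /conj_mx map_trmx.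
  rewrite -h2; apply/matrixP => i k; rewrite !mxE rmorph_sum.
  by apply: eq_bigr => j _; rewrite mxE.
Qed.

(** The vectorised identity has real entries. The cost sees only the real part of the overlap, hence
    does not change under conjugation. *)
Lemma overlap_conj P : overlap (conj_mx P) = (overlap P)^*.
Proof.
rewrite !overlapE rmorph_sum; apply: eq_bigr => i _.
by rewrite rmorph_sum; apply: eq_bigr => k _; rewrite mxE.
Qed.

Lemma coupling_cost_conj (rho omega : 'M[C]_2) x :
  (exists P, coupling rho omega P /\ x = complex.Re (\tr (P *m cost_op paulis))) ->
  exists P, coupling (conj_mx rho) (conj_mx omega) P /\
    x = complex.Re (\tr (P *m cost_op paulis)).
Proof.
move=> [P [cP ->]]; have cP' := coupling_conj cP.
exists (conj_mx P); split => //.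
case: cP cP' => [[_ tP] _] [[_ tP'] _].
by rewrite !Re_cost // overlap_conj; case: (overlap P).
Qed.

Lemma D2_conj (rho omega : 'M[C]_2) :
  D2 paulis (conj_mx rho) (conj_mx omega) = D2 paulis rho omega.
Proof.
congr inf; apply/seteqP; split => x /=; last exact: coupling_cost_conj.
by move/coupling_cost_conj; rewrite !conj_mxK.
Qed.

Lemma d_sym_unitary (V rho omega : 'M[C]_2) : unitary V ->
  d_sym (unitary_conj V rho) (unitary_conj V omega) = d_sym rho omega.
Proof. by move=> hV; rewrite /d_sym /dA !D2_unitary. Qed.

Lemma d_sym_antiunitary (V rho omega : 'M[C]_2) : unitary V ->
  d_sym (antiunitary_conj V rho) (antiunitary_conj V omega) = d_sym rho omega.
Proof.
move=> hV; rewrite -(d_sym_unitary rho omega hV) /d_sym /dA.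
by rewrite !(D2_unitary (conj_mx _)) // !D2_unitary // !D2_conj.
Qed.

End Invariance.

(** * Two-by-two minors, square roots and the bound on the self-distance *)

Section PureStates.
Variable R : realType.
Local Notation C := R[i].
Local Notation paulis := [:: sigma1 R; sigma2 R; sigma3 R].

Lemma ge0_ReK (z : C) : 0 <= z -> (complex.Re z)%:C%C = z.
Proof. by move=> /ger0_real/RRe_real. Qed.

Lemma Re_ge0 (z : C) : 0 <= z -> 0 <= complex.Re z.
Proof. by rewrite lecE => /andP[]. Qed.

Lemma herm_entry n (A : 'M[C]_n) i j : A = adj A -> A j i = (A i j)^*.
Proof. by move=> hA; rewrite [in LHS]hA adjE. Qed.

(** Evaluation on a vector supported on two coordinates; the positivity estimates on entries below
    all come from it. *)
Lemma qform2 n (A : 'M[C]_n) x y (a b : C) :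
  let v : 'cV[C]_n := a *: delta_mx x 0 + b *: delta_mx y 0 in
  (adj v *m A *m v) 0 0 =
  a^* * a * A x x + a^* * b * A x y + b^* * a * A y x + b^* * b * A y y.
Proof.
have entry i j : (delta_mx 0 i *m A *m delta_mx j 0 : 'M[C]_1) 0 0 = A i j.
  by rewrite -rowE -colE !mxE.
have adj_delta i : adj (delta_mx i 0 : 'cV[C]_n) = delta_mx 0 i.
  by apply/matrixP => k l; rewrite !mxE andbC conjC_nat.
pose B (u w : 'cV[C]_n) : C := (adj u *m A *m w) 0 0.
have BDl u v w : B (u + v) w = B u w + B v w by rewrite /B adjD !mulmxDl mxE.
have BDr u v w : B u (v + w) = B u v + B u w by rewrite /B mulmxDr mxE.
have BZl c u w : B (c *: u) w = c^* * B u w.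
  by rewrite /B adj_scale -!scalemxAl mxE.
have BZr c u w : B u (c *: w) = c * B u w by rewrite /B -scalemxAr mxE.
have BE i j : B (delta_mx i 0) (delta_mx j 0) = A i j by rewrite /B adj_delta entry.
rewrite /= -/(B _ _) BDl !BDr !BZl !BZr !BE; clear.
by move: (A x x) (A x y) (A y x) (A y y) => *; ring.
Qed.

Lemma psd_diag n (A : 'M[C]_n) x : psd A -> 0 <= A x x.
Proof.
move=> [_ /(_ (1 *: delta_mx x 0 + 0 *: delta_mx x 0))]; rewrite qform2.
by rewrite conjC1 conjC0 !mul0r !mulr0 !mul0r !mul1r !addr0.
Qed.

Lemma quadratic_minor (a b m : R) : 0 <= a -> 0 <= b -> 0 <= m ->
  (forall t, 0 <= t ^+ 2 * a - t * m *+ 2 + m * b) -> m <= a * b.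
Proof.
move=> a0 b0 m0 h; have [b_gt0|] := ltP 0 b; first by have := h b; nra.
move=> b_le0; have b00 : b = 0 by lra.
(* For [b = 0] this [t] makes the hypothesis read [t ^+ 2 * (a + 2) <= 0], so [t] and then [m]
   vanish. *)
have [t mE] : exists t, m = t * (a + 1) by exists (m / (a + 1)); field; lra.
have := h t; rewrite b00 mE => ht.
have t2 : t ^+ 2 <= 0 by have := mulr_ge0 (sqr_ge0 t) a0; lra.
have /eqP -> : t == 0 by rewrite -sqrf_eq0 eq_le t2 sqr_ge0.
by rewrite mul0r mulr0.
Qed.

(** Cauchy-Schwarz for the semidefinite form. In particular a zero diagonal entry kills its row and
    column. *)
Lemma psd_minor n (A : 'M[C]_n) x y : psd A ->
  A x y * (A x y)^* <= A x x * A y y.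
Proof.
move=> pA; have xx0 := psd_diag x pA; have yy0 := psd_diag y pA.
case: (pA) => hA qA.
have m0 : 0 <= A x y * (A x y)^* by apply: mul_conjC_ge0.
have key t : 0 <= t%:C%C ^+ 2 * A x x - t%:C%C * (A x y * (A x y)^*) *+ 2
                  + A x y * (A x y)^* * A y y.
  (* With [- (A x y)^*] as second coefficient the form becomes a real quadratic in [t] whose other
     coefficients involve only the squared modulus of [A x y] and the diagonal. *)
  have := qA (t%:C%C *: delta_mx x 0 + (- (A x y)^*) *: delta_mx y 0).
  rewrite qform2 (herm_entry x y hA) rmorphN /= conjCK.
  have -> : (t%:C%C)^* = t%:C%C by exact: conjc_real.
  by congr (0 <= _); ring.
move: key; rewrite -(ge0_ReK xx0) -(ge0_ReK yy0) -(ge0_ReK m0) => key.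
rewrite -rmorphM lecR; apply: quadratic_minor; try exact: Re_ge0.
move=> t; have := key t.
by rewrite -!rmorphM -rmorphXn -rmorphM -rmorphMn -rmorphB -rmorphD ler0c.
Qed.

(** With [s] the root of the determinant, Cayley-Hamilton and trace one give that [rho + s%:M]
    squares to [(1 + 2 * s) *: rho]. Rescaling yields the root [X], and the squared modulus of its
    trace is [1 + 2 * s]. *)
Lemma density_sqrt (rho : 'M[C]_2) : density rho ->
  exists X : 'M[C]_2, [/\ X = adj X, X *m X = rho & 1 <= \tr X * (\tr X)^*].
Proof.
move=> [pr tr1]; have [hr _] := pr; rewrite mxtrace2 in tr1.
pose d := rho 0 0 * rho 1 1 - rho 0 1 * rho 1 0.
have d0 : 0 <= d by rewrite subr_ge0 (herm_entry 0 1 hr); apply: psd_minor.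
pose s := sqrtC d; have s0 : 0 <= s by rewrite sqrtC_ge0.
have ss : s * s = d by rewrite -expr2 sqrtCK.
have t0 : 0 < 1 + 2 * s by rewrite ltr_wpDr // mulr_ge0.
pose k := (sqrtC (1 + 2 * s))^-1.
have k0 : 0 < k by rewrite invr_gt0 sqrtC_gt0.
have kk : k * k * (1 + 2 * s) = 1.
  by rewrite -invfM -expr2 sqrtCK mulVf // gt_eqF.
have conj_s : s^* = s by apply: conj_Creal; apply: ger0_real.
have conj_k : k^* = k by apply: conj_Creal; apply: gtr0_real.
exists (k *: (rho + s%:M)); split.
- by rewrite adj_scale adjD adj_scalar conj_s conj_k -hr.
- have XE i j : (k *: (rho + s%:M)) i j = k * (rho i j + s *+ (i == j)).
    by rewrite !mxE.
  apply: mx2_eq; rewrite mulmx2E !XE /= ?mulr0n ?mulr1n; apply/eqP; rewrite -subr_eq0.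
  + have -> : k * (rho 0 0 + s) * (k * (rho 0 0 + s))
      + k * (rho 0 1 + 0) * (k * (rho 1 0 + 0)) - rho 0 0
      = (k * k * (1 + 2 * s) - 1) * rho 0 0 + k * k * (s * s - d)
        + k * k * rho 0 0 * (rho 0 0 + rho 1 1 - 1) by rewrite /d; ring.
    by rewrite kk ss tr1 !subrr mul0r !mulr0 !addr0.
  + have -> : k * (rho 0 0 + s) * (k * (rho 0 1 + 0))
      + k * (rho 0 1 + 0) * (k * (rho 1 1 + s)) - rho 0 1
      = (k * k * (1 + 2 * s) - 1) * rho 0 1
        + k * k * rho 0 1 * (rho 0 0 + rho 1 1 - 1) by ring.
    by rewrite kk tr1 !subrr mul0r !mulr0 !addr0.
  + have -> : k * (rho 1 0 + 0) * (k * (rho 0 0 + s))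
      + k * (rho 1 1 + s) * (k * (rho 1 0 + 0)) - rho 1 0
      = (k * k * (1 + 2 * s) - 1) * rho 1 0
        + k * k * rho 1 0 * (rho 0 0 + rho 1 1 - 1) by ring.
    by rewrite kk tr1 !subrr mul0r !mulr0 !addr0.
  + have -> : k * (rho 1 0 + 0) * (k * (rho 0 1 + 0))
      + k * (rho 1 1 + s) * (k * (rho 1 1 + s)) - rho 1 1
      = (k * k * (1 + 2 * s) - 1) * rho 1 1 + k * k * (s * s - d)
        + k * k * rho 1 1 * (rho 0 0 + rho 1 1 - 1) by rewrite /d; ring.
    by rewrite kk ss tr1 !subrr mul0r !mulr0 !addr0.
- have -> : \tr (k *: (rho + s%:M)) = k * (1 + 2 * s).
    by rewrite linearZ /= linearD /= mxtrace2 tr1 mxtrace_scalar mulr_natl.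
  rewrite rmorphM /= conj_k rmorphD rmorphM /= conjC1 conjC_nat conj_s.
  have -> : k * (1 + 2 * s) * (k * (1 + 2 * s)) = k * k * (1 + 2 * s) * (1 + 2 * s).
    by ring.
  by rewrite kk mul1r lerDl mulr_ge0.
Qed.

(** Positivity on the difference of the basis vectors (0,0) and (1,1) bounds the cross terms of the
    overlap. Costs are therefore nonnegative, so the infimum is a genuine lower bound. *)
Lemma overlap_le2 P : density P -> overlap P <= 2 :> C.
Proof.
move=> [pP tP]; rewrite -subr_ge0.
have := pP.2 (1 *: delta_mx (mxtens_index (0, 0)) 0
  + (-1) *: delta_mx (mxtens_index (1, 1)) 0).
rewrite qform2 rmorphN /= conjC1 => h.
have -> : 2 = 2 * \tr P by rewrite tP mulr1.
rewrite [\tr P]sum_mxtens overlapE !sum_ord2.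
have h01 := psd_diag (mxtens_index (0, 1)) pP.
have h10 := psd_diag (mxtens_index (1, 0)) pP.
apply: le_trans (addr_ge0 h (mulr_ge0 (ler0n C 2) (addr_ge0 h01 h10))) _.
by rewrite le_eqVlt; apply/orP; left; apply/eqP; ring.
Qed.

Lemma D2_le (rho omega : 'M[C]_2) P : coupling rho omega P ->
  D2 paulis rho omega <= 8 - 4 * complex.Re (overlap P).
Proof.
move=> cP; apply: ge_inf; last by exists P; split; rewrite ?Re_cost //; case: cP => -[].
exists 0 => _ /= [Q [[dQ _] ->]]; rewrite Re_cost; last by case: dQ.
have := overlap_le2 dQ; rewrite lecE => /andP[_].
have -> : complex.Re (2 : C) = 2.
  by have -> : (2 : C) = (2 : R)%:C%C by rewrite rmorph_nat.
by lra.
Qed.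

(** The coupling is the rank-one operator of [vecc X], with [X] the square root of [rho]: its
    marginals are [X *m adj X] and the transpose of [adj X *m X], and its overlap is the squared
    modulus of [\tr X], at least 1. *)
Lemma D2_self_le4 (rho : 'M[C]_2) : density rho -> D2 paulis rho rho <= 4.
Proof.
move=> dr; have [X [hX XX tX]] := density_sqrt dr.
have rhoE : rho = X *m adj X by rewrite -hX.
have rhoE' : rho = adj X *m X by rewrite -hX.
have PE i j k l : (vecc X *m adj (vecc X)) (mxtens_index (i, j)) (mxtens_index (k, l))
    = X i j * (X k l)^*.
  by rewrite mxE big_ord1 adjE !veccE.
have ovl : overlap (vecc X *m adj (vecc X)) = \tr X * (\tr X)^*.
  rewrite overlapE mulr_suml; apply: eq_bigr => i _.
  by rewrite rmorph_sum mulr_sumr; apply: eq_bigr => k _; rewrite PE.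
apply: le_trans (D2_le (P := vecc X *m adj (vecc X)) _) _.
  split; [split|split].
  - exact: gram_psd.
  - rewrite [\tr _]sum_mxtens; rewrite -(proj2 dr) rhoE.
    apply: eq_bigr => i _; rewrite [RHS]mxE; apply: eq_bigr => j _.
    by rewrite PE adjE.
  - rewrite rhoE; apply/matrixP => i k; rewrite [LHS]mxE [RHS]mxE;
    apply: eq_bigr => j _.
    by rewrite PE adjE.
  - rewrite rhoE'; apply/matrixP => j l; rewrite [LHS]mxE [RHS]mxE [RHS]mxE;
    apply: eq_bigr => i _.
    by rewrite PE adjE mulrC.
rewrite ovl; move: tX; rewrite lecE => /andP[_ /=].
by lra.
Qed.

End PureStates.

(** * Explicit matrices and the structure of pure states *)

Section Wigner.
Variable R : realType.
Local Notation C := R[i].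
Local Notation paulis := [:: sigma1 R; sigma2 R; sigma3 R].

Definition mx2 (a b c d : C) : 'M[C]_2 :=
  \matrix_(i, j) if i == 0 then if j == 0 then a else b
                 else if j == 0 then c else d.

Lemma mx2E a b c d :
  (mx2 a b c d 0 0 = a) * (mx2 a b c d 0 1 = b) *
  (mx2 a b c d 1 0 = c) * (mx2 a b c d 1 1 = d).
Proof. by rewrite !mxE. Qed.

Lemma adj_mx2 a b c d : adj (mx2 a b c d) = mx2 a^* c^* b^* d^*.
Proof. by apply: mx2_eq; rewrite adjE !mx2E. Qed.

Lemma conj_mx2 a b c d : conj_mx (mx2 a b c d) = mx2 a^* b^* c^* d^*.
Proof. by apply: mx2_eq; rewrite [LHS]mxE !mx2E. Qed.

Lemma mul_mx2 a b c d a' b' c' d' : mx2 a b c d *m mx2 a' b' c' d' =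
  mx2 (a * a' + b * c') (a * b' + b * d') (c * a' + d * c') (c * b' + d * d').
Proof. by apply: mx2_eq; rewrite mulmx2E !mx2E. Qed.

Lemma mx2_1 : mx2 1 0 0 1 = 1%:M.
Proof. by apply: mx2_eq; rewrite mx2E mxE. Qed.

Lemma mx2_eta (A : 'M[C]_2) : A = mx2 (A 0 0) (A 0 1) (A 1 0) (A 1 1).
Proof. by apply: mx2_eq; rewrite mx2E. Qed.

Lemma mxtrace_mx2 (A : 'M[C]_2) a b c d :
  \tr (A *m mx2 a b c d) = A 0 0 * a + A 0 1 * c + A 1 0 * b + A 1 1 * d.
Proof. by rewrite mxtrace2 !mulmx2E !mx2E addrA. Qed.

(** On the Bloch sphere [E0] and [E1] are the two poles; [Px] and [Py] are the equatorial points on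
    the first and second axes. *)
Definition E0 := mx2 1 0 0 0.
Definition E1 := mx2 0 0 0 1.
Definition Px := mx2 2^-1 2^-1 2^-1 2^-1.
Definition Py := mx2 2^-1 (- ('i / 2)) ('i / 2) 2^-1.

Lemma idem_trace1_pure (A : 'M[C]_2) :
  A = adj A -> A *m A = A -> \tr A = 1 -> pure A.
Proof.
move=> hA AA tA; split=> //; split=> //.
have := rank_leq_row A; rewrite leq_eqVlt ltnS leq_eqVlt ltnS leqn0.
case/or3P => [|/eqP//|].
  rewrite -/(row_free A) row_free_unit => uA.
  have A1 : A = 1%:M by rewrite -[LHS](mulKmx uA) AA mulVmx.
  move: tA; rewrite A1 mxtrace_scalar => /eqP.
  by rewrite -[2%:R]/(1 + 1) addrC -subr_eq0 addrK oner_eq0.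
rewrite mxrank_eq0 => /eqP A0; move: tA; rewrite A0 mxtrace0 => /eqP.
by rewrite eq_sym oner_eq0.
Qed.

(** If the trace were not 1, idempotency would force the off-diagonal entries to vanish. The
    diagonal entries are then both 0 or both 1, giving rank zero or two. *)
Lemma pure_trace1 (A : 'M[C]_2) : pure A -> \tr A = 1.
Proof.
move=> [hA [AA rA]]; apply/eqP; rewrite -subr_eq0; apply/negPn/negP => t1.
have E i j : A i 0 * A 0 j + A i 1 * A 1 j = A i j by rewrite -mulmx2E AA.
have b0 : A 0 1 = 0.
  apply: (mulfI t1); rewrite mulr0 mxtrace2.
  have -> : (A 0 0 + A 1 1 - 1) * A 0 1 = A 0 0 * A 0 1 + A 0 1 * A 1 1 - A 0 1 by ring.
  by rewrite E subrr.
have c0 : A 1 0 = 0.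
  apply: (mulfI t1); rewrite mulr0 mxtrace2.
  have -> : (A 0 0 + A 1 1 - 1) * A 1 0 = A 1 0 * A 0 0 + A 1 1 * A 1 0 - A 1 0 by ring.
  by rewrite E subrr.
have idem (z : C) : z * z = z -> z = 0 \/ z = 1.
  move=> /eqP; rewrite -subr_eq0 -{3}[z]mulr1 -mulrBr mulf_eq0 subr_eq0.
  by case/orP => /eqP; [left | right].
have aa : A 0 0 * A 0 0 = A 0 0 by rewrite -[RHS]E b0 mul0r addr0.
have dd : A 1 1 * A 1 1 = A 1 1 by rewrite -[RHS]E c0 mul0r add0r.
move: t1 rA; rewrite mxtrace2 [in \rank A](mx2_eta A) b0 c0.
case: (idem _ aa) => ->; case: (idem _ dd) => ->; rewrite ?add0r ?addr0 ?subrr ?eqxx //.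
- by rewrite (_ : mx2 0 0 0 0 = 0) ?mxrank0 //; apply: mx2_eq; rewrite mx2E mxE.
- by rewrite mx2_1 mxrank1.
Qed.

Lemma pure_unitary (A : 'M[C]_2) : pure A ->
  exists V, unitary V /\ A = unitary_conj V E0.
Proof.
move=> pA; have tA := pure_trace1 pA; case: (pA) => hA [AA _].
rewrite mxtrace2 in tA.
have E i j : A i 0 * A 0 j + A i 1 * A 1 j = A i j by rewrite -mulmx2E AA.
have cE := herm_entry 0 1 hA; have bE := herm_entry 1 0 hA.
have aE := herm_entry 0 0 hA.
have bc : A 0 1 * A 1 0 = A 0 0 * A 1 1.
  have -> : A 1 1 = 1 - A 0 0 by rewrite -tA addrAC subrr add0r.
  by rewrite (canRL (addKr _) (E 0 0)); ring.
have a0 : 0 <= A 0 0.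
  by rewrite -E {2}aE cE addr_ge0 ?mul_conjC_ge0.
have AE := mx2_eta A; rewrite /unitary /unitary_conj.
(* If the corner entry vanishes then [A] is [E1], and the swap of the basis vectors serves. *)
have [az|anz] := eqVneq (A 0 0) 0.
  have d1 : A 1 1 = 1 by rewrite -tA az add0r.
  have b0 : A 0 1 = 0 by apply/eqP; rewrite -mul_conjC_eq0 -cE bc az mul0r.
  have c0 : A 1 0 = 0 by rewrite cE b0 conjC0.
  exists (mx2 0 1 1 0); rewrite adj_mx2 conjC0 conjC1 !mul_mx2 -mx2_1.
  rewrite [A]mx2_eta az b0 c0 d1 ?(mul0r, mulr0, mul1r, add0r, addr0).
  by [].
pose s := sqrtC (A 0 0).
have s0 : 0 < s by rewrite sqrtC_gt0 lt_def anz.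
have ss : A 0 0 = s * s by rewrite -expr2 sqrtCK.
have snz : s != 0 by rewrite gt_eqF.
have conj_s : s^* = s by apply: conj_Creal; apply: gtr0_real.
have dE : A 1 0 / s * (A 0 1 / s) = A 1 1.
  apply: (mulfI anz); rewrite -bc ss; field; exact: snz.
have one : s * s + A 0 1 / s * (A 1 0 / s) = 1.
  by rewrite [X in _ + X]mulrC dE -ss.
(* The first column is the unit vector spanning the range of [A], namely its column 0 divided by
   [s]; the second is orthogonal to it. *)
exists (mx2 s (- (A 0 1 / s)) (A 1 0 / s) s).
rewrite adj_mx2 conj_s rmorphN !rmorphM /= fmorphV /= conj_s -cE -bE !mul_mx2 -mx2_1.
split.
  congr mx2; first by rewrite mulrNN.
  - by field.
  - by field.
  - by rewrite dE -ss addrC.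
rewrite [A in LHS]mx2_eta; congr mx2; rewrite !(mulr1, mulr0, mul0r, addr0) //.
- by field.
- by field.
Qed.

End Wigner.

(** * Distance to a pure state and the classification of isometries *)

Section Isometries.
Variable R : realType.
Local Notation C := R[i].
Local Notation paulis := [:: sigma1 R; sigma2 R; sigma3 R].
Local Notation E0 := (E0 R).
Local Notation E1 := (E1 R).
Local Notation Px := (Px R).
Local Notation Py := (Py R).

Lemma half_half : 2^-1 + 2^-1 = 1 :> C.
Proof. by field. Qed.

Lemma conj_half : (2^-1)^* = 2^-1 :> C.
Proof. by rewrite fmorphV /= conjC_nat. Qed.

Lemma pure_E0 : pure E0.
Proof.
apply: idem_trace1_pure; rewrite /E0.
- by rewrite adj_mx2 conjC0 conjC1.
- by rewrite mul_mx2 !(mul0r, mulr0, mul1r, addr0).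
- by rewrite mxtrace2 !mx2E addr0.
Qed.

Lemma pure_E1 : pure E1.
Proof.
apply: idem_trace1_pure; rewrite /E1.
- by rewrite adj_mx2 conjC0 conjC1.
- by rewrite mul_mx2 !(mul0r, mulr0, mul1r, add0r).
- by rewrite mxtrace2 !mx2E add0r.
Qed.

Lemma pure_Px : pure Px.
Proof.
apply: idem_trace1_pure; rewrite /Px.
- by rewrite adj_mx2 conj_half.
- by rewrite mul_mx2 -mulrDl half_half mul1r.
- by rewrite mxtrace2 !mx2E half_half.
Qed.

Lemma conj_half_i : ('i / 2)^* = - ('i / 2) :> C.
Proof. by rewrite rmorphM /= conj_half conjCi mulNr. Qed.

Lemma half_i_sq : ('i / 2) * ('i / 2) = - (2^-1 * 2^-1) :> C.
Proof.
have ii := sqrCi C; rewrite expr2 in ii.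
by rewrite mulrACA ii mulN1r.
Qed.

Lemma pure_Py : pure Py.
Proof.
apply: idem_trace1_pure; rewrite /Py.
- by rewrite adj_mx2 rmorphN /= conj_half_i conj_half opprK.
- rewrite mul_mx2 !mulNr !mulrN half_i_sq !opprK.
  by congr mx2; field.
- by rewrite mxtrace2 !mx2E half_half.
Qed.

Lemma pure_unitary_conj (V A : 'M[C]_2) :
  unitary V -> pure A -> pure (unitary_conj V A).
Proof.
move=> hV pA; have tA := pure_trace1 pA; case: pA => hA [AA _].
apply: idem_trace1_pure; rewrite /unitary_conj.
- by rewrite !adjM adjK -hA mulmxA.
- rewrite !mulmxA -[_ *m adj V *m V]mulmxA (unitaryC hV) mulmx1.
  by rewrite -[V *m A *m A]mulmxA AA.
- by rewrite mxtrace_mulC mulmxA (unitaryC hV) mul1mx.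
Qed.

Lemma pure_density (A : 'M[C]_2) : pure A -> density A.
Proof.
move=> pA; split; last exact: pure_trace1.
by case: pA => hA [AA _]; rewrite -AA {2}hA; apply: gram_psd.
Qed.

(** The marginal [E0] kills the diagonal entries of [P] with first index 1, and positivity kills the
    row and column of (1,1). Only one entry remains in the overlap, and the other marginal fixes
    it. *)
Lemma coupling_E0 (rho : 'M[C]_2) P : coupling rho E0 P -> overlap P = rho 0 0.
Proof.
move=> [[pP _] [h1 h2]].
have z11 : P (mxtens_index (1, 0)) (mxtens_index (1, 0)) = 0 /\
           P (mxtens_index (1, 1)) (mxtens_index (1, 1)) = 0.
  have := congr1 (fun M : 'M[C]_2 => M 1 1) h1; rewrite mxE sum_ord2 mx2E.
  move=> /eqP; rewrite paddr_eq0 ?psd_diag //.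
  by case/andP => /eqP-> /eqP->.
case: z11 => z10 z11.
have z x : P x (mxtens_index (1, 1)) = 0.
  apply/eqP; rewrite -mul_conjC_eq0 eq_le mul_conjC_ge0 andbT.
  by apply: le_trans (psd_minor x _ pP) _; rewrite z11 mulr0.
have z' x : P (mxtens_index (1, 1)) x = 0.
  by rewrite (herm_entry x _ (proj1 pP)) z conjC0.
have := congr1 (fun M : 'M[C]_2 => M 0 0) h2; rewrite mxE sum_ord2 z10 addr0 mxE.
by rewrite overlapE !sum_ord2 !z !z' !addr0.
Qed.

Lemma coupling_E0_tens (rho : 'M[C]_2) : density rho ->
  coupling rho E0 (E0 *t rho^T).
Proof.
move=> dr; have [X [hX XX _]] := density_sqrt dr.
have tE0 := pure_trace1 pure_E0; case: pure_E0 => hE [EE _].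
split; [split|split].
- have -> : E0 *t rho^T = (E0 *t X^T) *m adj (E0 *t X^T).
    rewrite adj_tens tensmx_mul -hE EE; congr (_ *t _).
    rewrite -XX trmx_mul; congr (_ *m _).
    by rewrite {1}hX; apply/matrixP => i j; rewrite !mxE.
  exact: gram_psd.
- by rewrite mxtrace_tens mxtrace_tr tE0 mul1r; case: dr.
- by rewrite ptr_Hstar_tens mxtrace_tr (proj2 dr) scale1r.
- by rewrite ptr_H_tens tE0 scale1r.
Qed.

(** All couplings have the same cost and the product coupling exists, so the infimum is over a
    singleton. *)
Lemma D2_E0 (rho : 'M[C]_2) : density rho ->
  D2 paulis rho E0 = 8 - 4 * complex.Re (rho 0 0).
Proof.
move=> dr; rewrite -[RHS]inf1; congr inf; apply/seteqP; split => x /=.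
  by move=> [P [cP ->]]; rewrite Re_cost ?(coupling_E0 cP) //; case: cP => -[].
move=> ->; have cP := coupling_E0_tens dr; exists (E0 *t rho^T); split => //.
by rewrite Re_cost ?(coupling_E0 cP) //; case: cP => -[].
Qed.

(** Unitary invariance reduces to [E0], where the trace becomes a diagonal entry of a density
    matrix, hence at most 1. *)
Lemma D2_pure (rho omega : 'M[C]_2) : density rho -> pure omega ->
  D2 paulis rho omega = 8 - 4 * complex.Re (\tr (rho *m omega)) /\
  complex.Re (\tr (rho *m omega)) <= 1.
Proof.
move=> dr /pure_unitary[V [hV ->]]; have hV' := unitary_adj hV.
have dr' := density_unitary_conj hV' dr.
rewrite -{1 2 3}(unitary_conjK rho hV) D2_unitary // D2_E0 //.
rewrite mxtrace_unitary_conj // mxtrace_mx2 mulr1 !mulr0 !addr0; split=> //.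
case: dr' => /(psd_diag 1) h; rewrite mxtrace2 => t.
have : unitary_conj (adj V) rho 0 0 <= 1 by rewrite -t lerDl.
by rewrite lecE => /andP[].
Qed.

Lemma D2_pure_self (omega : 'M[C]_2) : pure omega -> D2 paulis omega omega = 4.
Proof.
move=> po; rewrite (proj1 (D2_pure (pure_density po) po)).
by rewrite (proj1 (proj2 po)) (pure_trace1 po) /=; lra.
Qed.

(** Nonnegativity of [x] follows from the overlap bound 1 and the self-distance bound 4. It matters
    because [Num.sqrt] is constant on negative numbers and injective only on nonnegative ones. *)
Lemma d_sym_pure (rho omega : 'M[C]_2) : density rho -> pure omega ->
  let x := 6 - 4 * complex.Re (\tr (rho *m omega)) - D2 paulis rho rho / 2 in
  d_sym rho omega = Num.sqrt x /\ 0 <= x.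
Proof.
move=> dr po /=; have [D2E t1] := D2_pure dr po; have q4 := D2_self_le4 dr.
split; last by lra.
rewrite /d_sym /dA D2E (D2_pure_self po); congr Num.sqrt; lra.
Qed.

Definition pure_isometry (Phi : 'M[C]_2 -> 'M[C]_2) :=
  [/\ forall rho, density rho -> density (Phi rho),
      forall rho omega, density rho -> density omega ->
        d_sym (Phi rho) (Phi omega) = d_sym rho omega &
      forall rho, pure rho -> pure (Phi rho)].

Lemma pure_isometry_conj V Phi : unitary V -> pure_isometry Phi ->
  pure_isometry (fun rho => unitary_conj V (Phi rho)).
Proof.
move=> hV [hd hi hp]; split.
- by move=> rho /hd; apply: density_unitary_conj.
- by move=> rho omega dr dw; rewrite d_sym_unitary // hi.
- by move=> rho /hp; apply: pure_unitary_conj.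
Qed.

Lemma real_eq_Re (x y : C) : x^* = x -> y^* = y ->
  complex.Re x = complex.Re y -> x = y.
Proof.
move=> /CrealP xR /CrealP yR h.
by rewrite -(RRe_real xR) -(RRe_real yR) h.
Qed.

Lemma density_herm (rho : 'M[C]_2) : density rho -> rho = adj rho.
Proof. by case=> -[]. Qed.

(** * Rigidity of an isometry that fixes [E0], then also [Px] *)

Section FixedIsometry.
Variable Phi : 'M[C]_2 -> 'M[C]_2.
Hypothesis Phi_iso : pure_isometry Phi.

Lemma isometry_cost rho omega : density rho -> pure omega ->
  4 * complex.Re (\tr (Phi rho *m Phi omega)) + D2 paulis (Phi rho) (Phi rho) / 2 =
  4 * complex.Re (\tr (rho *m omega)) + D2 paulis rho rho / 2.
Proof.
case: Phi_iso => hd hi hp dr po; have := hi _ _ dr (pure_density po).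
have [-> x0] := d_sym_pure dr po.
have [-> y0] := d_sym_pure (hd _ dr) (hp _ po).
by move/eqP; rewrite eqr_sqrt // => /eqP; lra.
Qed.

Lemma isometry_trace_pure rho omega : pure rho -> pure omega ->
  \tr (Phi rho *m Phi omega) = \tr (rho *m omega).
Proof.
case: Phi_iso => hd hi hp pr po; have := isometry_cost (pure_density pr) po.
rewrite (D2_pure_self pr) (D2_pure_self (hp _ pr)) => h.
apply: real_eq_Re; last by lra.
all: by apply: mxtrace_herm_real; apply/density_herm/pure_density; auto.
Qed.

(** Orthogonality to [E0] is preserved, so the corner entry of the image is 0; positivity and unit
    trace determine the rest. *)
Lemma fix_E1 : Phi E0 = E0 -> Phi E1 = E1.
Proof.
case: Phi_iso => hd hi hp fE0; have [pB tB] := hd _ (pure_density pure_E1).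
have := isometry_trace_pure pure_E1 pure_E0.
rewrite fE0 !mxtrace_mx2 !mx2E !(mulr0, mul0r, mulr1, addr0) => b0.
have h01 : Phi E1 0 1 = 0.
  apply/eqP; rewrite -mul_conjC_eq0 eq_le mul_conjC_ge0 andbT.
  by apply: le_trans (psd_minor _ _ pB) _; rewrite b0 mul0r.
apply: mx2_eq; rewrite !mx2E //.
  by rewrite (herm_entry 0 1 (proj1 pB)) h01 conjC0.
by rewrite -tB mxtrace2 b0 add0r.
Qed.

Hypothesis fE0 : Phi E0 = E0.

Let mul_E0 (A : 'M[C]_2) : \tr (A *m E0) = A 0 0.
Proof. by rewrite mxtrace_mx2 !mulr0 !addr0 mulr1. Qed.

Let mul_E1 (A : 'M[C]_2) : \tr (A *m E1) = A 1 1.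
Proof. by rewrite mxtrace_mx2 !mulr0 !add0r mulr1. Qed.

Lemma isometry_trace rho omega : density rho -> pure omega ->
  \tr (Phi rho *m Phi omega) = \tr (rho *m omega).
Proof.
case: Phi_iso => hd hi hp dr po; have dp := hd _ dr.
(* Adding the identities for [E0] and [E1], whose traces against a state sum to 1, shows that [rho]
   and [Phi rho] have equal self-distance. That term then cancels for every pure [omega]. *)
have h0 := isometry_cost dr pure_E0; have h1 := isometry_cost dr pure_E1.
rewrite fE0 (fix_E1 fE0) !mul_E0 !mul_E1 in h0 h1.
have ReD (A : 'M[C]_2) : density A ->
    complex.Re (A 0 0) + complex.Re (A 1 1) = 1.
  move=> [_]; rewrite mxtrace2 => /(congr1 (@complex.Re R)).
  by case: (A 0 0) (A 1 1) => ? ? [].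
have s := ReD _ dr; have s' := ReD _ dp; have h := isometry_cost dr po.
apply: real_eq_Re; last by lra.
all: by apply: mxtrace_herm_real; apply: density_herm; auto using pure_density.
Qed.

(** Preserved traces against the two poles keep the Bloch equator invariant; the last equation is
    the corner entry of idempotency. *)
Lemma fixed_equator omega : pure omega -> omega 0 0 = 2^-1 -> omega 1 1 = 2^-1 ->
  [/\ Phi omega 0 0 = 2^-1, Phi omega 1 1 = 2^-1 &
      Phi omega 0 1 * Phi omega 1 0 = 2^-1 * 2^-1].
Proof.
move=> po w0 w1; have := isometry_trace (pure_density po) pure_E0.
rewrite fE0 !mul_E0 w0 => h0; have := isometry_trace (pure_density po) pure_E1.
rewrite (fix_E1 fE0) !mul_E1 w1 => h1; split => //.
case: Phi_iso => _ _ /(_ _ po)[_ [QQ _]].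
have := congr1 (fun M : 'M[C]_2 => M 0 0) QQ; rewrite mulmx2E h0.
by move/(canRL (addKr _)) => ->; field.
Qed.

Lemma phase_correction : exists V,
  [/\ unitary V, unitary_conj V E0 = E0 & unitary_conj V (Phi Px) = Px].
Proof.
have [] := fixed_equator pure_Px; rewrite ?mx2E //.
case: Phi_iso => hd _ _; have [[hQ _] _] := hd _ (pure_density pure_Px).
move: (Phi Px) hQ => Q hQ q0 q1 q01.
have cE := herm_entry 0 1 hQ; have bE := herm_entry 1 0 hQ.
have c1 : (2 * Q 0 1) * (2 * Q 1 0) = 1 by rewrite mulrACA q01; field.
(* A rotation about the third axis: [c1] says that the phase [2 * Q 0 1] has modulus 1. *)
exists (mx2 1 0 0 (2 * Q 0 1)); rewrite /unitary /unitary_conj adj_mx2.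
rewrite conjC0 conjC1 rmorphM /= conjC_nat -cE [Q]mx2_eta !mul_mx2 -mx2_1 !mx2E.
split; rewrite ?c1 ?q0 ?q1 ?(mul0r, mulr0, mul1r, mulr1, add0r, addr0) //.
congr mx2.
- by rewrite mulrCA q01; field.
- by rewrite -mulrA q01; field.
- by rewrite mulrAC c1 mul1r.
Qed.

Hypothesis fPx : Phi Px = Px.

(** The image lies on the equator, and its trace against [Px] makes the off-diagonal entries
    opposite. Their product is 1/4, so the lower one is a square root of -1/4. *)
Lemma Py_dichotomy : Phi Py = Py \/ Phi Py = conj_mx Py.
Proof.
have [] := fixed_equator pure_Py; rewrite ?mx2E // => s0 s1 s01.
have := isometry_trace (pure_density pure_Py) pure_Px.
rewrite fPx !mxtrace_mx2 !mx2E s0 s1 => h.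
have s10 : Phi Py 0 1 = - Phi Py 1 0.
  apply/eqP; rewrite -subr_eq0 opprK.
  have -> : Phi Py 0 1 + Phi Py 1 0 = 2 * (2^-1 * 2^-1 + Phi Py 0 1 * 2^-1
    + Phi Py 1 0 * 2^-1 + 2^-1 * 2^-1) - 1 by field.
  by rewrite h; apply/eqP; field.
have : (Phi Py 1 0 - 'i / 2) * (Phi Py 1 0 + 'i / 2) == 0.
  rewrite -subr_sqr !expr2 half_i_sq -s01 s10.
  by apply/eqP; ring.
rewrite conj_mx2 rmorphN /= conj_half_i conj_half opprK mulf_eq0 subr_eq0 addr_eq0.
case/orP => /eqP s; [left | right]; apply: mx2_eq; rewrite ?mx2E ?s10 ?s ?opprK //.
Qed.

(** [E0] and [E1] read off the diagonal, [Px] the sum and [Py] the difference of the off-diagonal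
    entries. *)
Lemma pauli_frame_inj (A B : 'M[C]_2) : \tr (A *m E0) = \tr (B *m E0) ->
  \tr (A *m E1) = \tr (B *m E1) -> \tr (A *m Px) = \tr (B *m Px) ->
  \tr (A *m Py) = \tr (B *m Py) -> A = B.
Proof.
rewrite !mul_E0 !mul_E1 !mxtrace_mx2 => h0 h1; rewrite h0 h1 => hx hy.
have hs : A 0 1 + A 1 0 = B 0 1 + B 1 0.
  move/addIr: hx; rewrite -!addrA => /addrI; rewrite -!mulrDl.
  by apply: mulIf; rewrite invr_eq0 pnatr_eq0.
have hd : A 0 1 - A 1 0 = B 0 1 - B 1 0.
  move/addIr: hy; rewrite -!addrA => /addrI; rewrite !mulrN -!mulrBl.
  by apply: mulIf; rewrite mulf_neq0 ?neq0Ci // invr_eq0 pnatr_eq0.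
have h01 : A 0 1 = B 0 1.
  have dbl (x y : C) : x = ((x + y) + (x - y)) / 2 by field.
  by rewrite (dbl (A 0 1) (A 1 0)) hs hd -dbl.
by apply: mx2_eq => //; move: hs; rewrite h01 => /addrI.
Qed.

Lemma isometry_id_or_conj :
  (forall rho, density rho -> Phi rho = rho) \/
  (forall rho, density rho -> Phi rho = conj_mx rho).
Proof.
have fE1 := fix_E1 fE0; case: Py_dichotomy => fPy; [left | right] => rho dr.
  by apply: pauli_frame_inj; [rewrite -{1}fE0 | rewrite -{1}fE1 |
    rewrite -{1}fPx | rewrite -{1}fPy]; apply: isometry_trace => //;
    [exact: pure_E0 | exact: pure_E1 | exact: pure_Px | exact: pure_Py].
(* In the second case conjugation is undone first: the preserved traces are real, and the conjugates
   of the images of the four frame states are the frame states themselves. *)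
have tr_conj omega : pure omega ->
    \tr (conj_mx (Phi rho) *m conj_mx (Phi omega)) = \tr (rho *m omega).
  move=> po; rewrite -conj_mxM mxtrace_conj isometry_trace //.
  by apply: mxtrace_herm_real; [exact: density_herm | exact/density_herm/pure_density].
rewrite -[LHS]conj_mxK; congr conj_mx; apply: pauli_frame_inj.
- rewrite -[RHS](tr_conj _ pure_E0) fE0; congr (\tr (_ *m _)).
  by rewrite conj_mx2 conjC0 conjC1.
- rewrite -[RHS](tr_conj _ pure_E1) fE1; congr (\tr (_ *m _)).
  by rewrite conj_mx2 conjC0 conjC1.
- rewrite -[RHS](tr_conj _ pure_Px) fPx; congr (\tr (_ *m _)).
  by rewrite conj_mx2 conj_half.
- by rewrite -[RHS](tr_conj _ pure_Py) fPy conj_mxK.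
Qed.

End FixedIsometry.

Lemma unitary_conjM (V W A : 'M[C]_2) :
  unitary_conj (V *m W) A = unitary_conj V (unitary_conj W A).
Proof. by rewrite /unitary_conj adjM !mulmxA. Qed.

(** [adj V] brings the image of [E0] back to [E0], then [W] corrects the phase of the image of [Px].
    Undoing both gives the unitary [V *m adj W]. *)
Lemma pure_isometry_normal_form Phi : pure_isometry Phi ->
  exists V : 'M[C]_2, unitary V /\
    ((forall rho, density rho -> Phi rho = unitary_conj V rho) \/
     (forall rho, density rho -> Phi rho = antiunitary_conj V rho)).
Proof.
move=> iso; have [_ _ hp] := iso.
have [V [hV eV]] := pure_unitary (hp _ pure_E0).
have hV' := unitary_adj hV; have iso1 := pure_isometry_conj hV' iso.
have f0 : unitary_conj (adj V) (Phi E0) = E0 by rewrite eV unitary_conjKV.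
have [W [hW w0 wx]] := phase_correction iso1 f0.
have iso2 := pure_isometry_conj hW iso1.
have PhiE rho : Phi rho = unitary_conj (V *m adj W)
    (unitary_conj W (unitary_conj (adj V) (Phi rho))).
  by rewrite unitary_conjM unitary_conjKV // unitary_conjK.
have g0 : unitary_conj W (unitary_conj (adj V) (Phi E0)) = E0 by rewrite f0.
exists (V *m adj W); split; first exact/unitary_mul/unitary_adj.
case: (isometry_id_or_conj iso2 g0 wx) => h; [left | right] => rho dr.
  by rewrite PhiE h.
by rewrite PhiE h.
Qed.

End Isometries.

Theorem theorem2p1 (R : realType) :
  (forall Phi : 'M[R[i]]_2 -> 'M[R[i]]_2,
     (forall rho, density rho -> density (Phi rho)) ->
     (forall rho omega, density rho -> density omega ->
        d_sym (Phi rho) (Phi omega) = d_sym rho omega) ->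
     (forall rho, pure rho -> pure (Phi rho)) ->
     exists V : 'M[R[i]]_2, unitary V /\
       ((forall rho, density rho -> Phi rho = unitary_conj V rho) \/
        (forall rho, density rho -> Phi rho = antiunitary_conj V rho)))
  /\
  (forall V : 'M[R[i]]_2, unitary V ->
     (forall rho omega, density rho -> density omega ->
        d_sym (unitary_conj V rho) (unitary_conj V omega) = d_sym rho omega) /\
     (forall rho omega, density rho -> density omega ->
        d_sym (antiunitary_conj V rho) (antiunitary_conj V omega) = d_sym rho omega)).
Proof.
split=> [Phi hd hi hp | V hV]; first exact: pure_isometry_normal_form.
by split=> rho omega _ _; [exact: d_sym_unitary | exact: d_sym_antiunitary].
Qed.
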